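(* Fix positive constants $\mathfrak C=\{\Gamma,\widetilde\Gamma,\lambda,b,c,\tilde c\}$ and constants $B,D\ge 1\ge \widetilde B,C>0$. There are constants $Q_1,\widetilde Q_1$ (depending only on $\Gamma,\widetilde\Gamma,\lambda,b,c,\tilde c,B,\widetilde B,C,D$, and not on $\Phi$, $\xi_0$, $k$ or $i$) such that for every $k\ge 1$ and every $1\le i\le k$ the following holds. If $\xi_0$ is $\mathfrak C$-quasi-hyperbolic up to time $k$ of type (I) (with constants $B,C,D$), then $$\|e^{(k)}-e^{(i)}\|\le Q_1\left(\frac{\Gamma\widetilde\Gamma c}{\lambda}\right)^i .$$ If $\xi_0$ is $\mathfrak C$-quasi-hyperbolic up to time $k$ of type (II) (with constants $B,\widetilde B,C,D$), then $$\|e^{(k)}-e^{(i)}\|\le \widetilde Q_1\left(\frac{c}{\tilde c}\right)^i .$$ In particular, in the non-singular setting, where one can take $\tilde c=1$ (and $\widetilde \Gamma=1$), one has $$\|e^{(k)}-e^{(i)}\|\le \widetilde Q_1\,c^{\,i}.$$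
   Context: Setting. $M$ is a two-dimensional Riemannian manifold, $\Phi:M\to M$ a map, $\xi_0\in M$, $\xi_i=\Phi^i(\xi_0)$, and $D\Phi^i_{\xi_0}:T_{\xi_0}M\to T_{\xi_i}M$ is the derivative of $\Phi^i$ at $\xi_0$, assumed invertible. Norms are operator norms for the Riemannian metric. $\Phi^i$ is ''$C^2$ at $\xi_0$'' if it is $C^2$ in a neighbourhood of $\xi_0$. $D^2\Phi_\xi$ is the second derivative of $\Phi$ at $\xi$, regarded as a bilinear map $T_\xi M\times T_\xi M\to T_{\Phi(\xi)}M$ (computed in normal coordinates at $\xi$ and $\Phi(\xi)$). Co-eccentricity. For $\xi\in M$ and $i\ge1$, $C_{\xi,i}:=\|(D\Phi^i_{\xi})^{-1}\|^{-1}/\|D\Phi^i_{\xi}\|\le 1$. Hyperbolic coordinates. If $C_{\xi_0,i}<1$, then $e^{(i)}$ and $f^{(i)}$ denote unit vectors in $T_{\xi_0}M$ most contracted, respectively most expanded, by $D\Phi^i_{\xi_0}$; each is unique up to sign and they are orthogonal. Signs are chosen consistently, so that $\langle e^{(j)},e^{(j+1)}\rangle\ge 0$ for all $j$ for which these are defined. Quasi-hyperbolicity. Given positive constants $\mathfrak C=\{\Gamma,\widetilde\Gamma,\lambda,b,c,\tilde c\}$, the point $\xi_0$ is $\mathfrak C$-quasi-hyperbolic up to time $k$ with constants $B,D\ge 1\ge\widetilde B,C>0$ if for every $1\le i\le k$ the map $\Phi^i$ is $C^2$ at $\xi_0$ and $$C\lambda^i<\|D\Phi^i_{\xi_0}\|<D\Gamma^i,\qquad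 C_{\xi_0,i}\le Bc^i<1,$$ $$\|D\Phi_{\xi_{i-1}}\|,\ \|D^2\Phi_{\xi_{i-1}}\|<D\,\Gamma\,\widetilde\Gamma^{\,i-1},\qquad |\det D\Phi_{\xi_{i-1}}|\le b,$$ where moreover $\widetilde\Gamma\ge 1$, $\Gamma>\max\{\lambda,1\}$, $b<\Gamma^2\widetilde\Gamma$, and at least one of the following holds: Type (I): $b<\lambda^2/\widetilde\Gamma$ and $c<\lambda^3/(\Gamma^3\widetilde\Gamma^3)<1$. Type (II): $C_{\xi_{i-1},1}\ge\widetilde B\,\tilde c^{\,i-1}$ for all $1\le i\le k$, $b<\lambda^2\tilde c$, and $c<\lambda^2\tilde c^2/(\Gamma^2\widetilde\Gamma)<\tilde c\le 1$. (When $\tilde c=\widetilde\Gamma=1$ the chain is read as $c<\lambda^2/\Gamma^2<1$.) Non-singular setting. This means $\widetilde\Gamma=1$ and: for every $1\le i\le k$, $\Phi^i$ is $C^2$ at $\xi_0$, $C\lambda^i<\|D\Phi^i_{\xi_0}\|<D\Gamma^i$, $C_{\xi_0,i}<Bc^i<1$, $\|D\Phi_{\xi_{i-1}}\|,\|D^2\Phi_{\xi_{i-1}}\|<D\Gamma$, $|\det D\Phi_{\xi_{i-1}}|\le b$, with $\Gamma\ge\max\{\lambda,1\}$, $b<\lambda^2$, $c<\lambda^2/\Gamma^2<1$. It is treated as type (II) with $\tilde c=\widetilde\Gamma=1$, where $\widetilde B\in(0,1]$ is a constant with $C_{\xi_{i-1},1}\ge\widetilde B$ for $1\le i\le k$.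 *)

(* Defs.v *)
(* MathComp + MathComp-Analysis; real numbers are an arbitrary realType. *)
From HB Require Import structures.
From mathcomp Require Import all_boot all_order all_algebra.
From mathcomp Require Import all_classical all_reals all_analysis.
Set Implicit Arguments.
Unset Strict Implicit.
Unset Printing Implicit Defensive.
Import Order.TTheory GRing.Theory Num.Theory.
Import numFieldNormedType.Exports.
Local Open Scope classical_set_scope.
Local Open Scope ring_scope.

(* Vectors are row vectors and linear maps act on the right, v |-> v *m A.
   This is the convention of the library's Jacobian 'J f x. *)

Section Regularity.
Variable R : realType.
Notation plane := 'rV[R]_2.

Definition bvec (i : 'I_2) : plane := delta_mx 0 i.

(* f is of class C^n on A; meant for open A. *)
Fixpoint Ck (n : nat) (A : set plane) (f : plane -> R) : Prop :=
  match n with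
  | 0 => forall x, A x -> {for x, continuous f}
  | m.+1 => (forall x, A x -> differentiable f x) /\
            (forall i, Ck m A (fun x => 'D_(bvec i) f x))
  end.

Definition smooth_on (A : set plane) (f : plane -> R) : Prop :=
  forall n, Ck n A f.

Definition CkV (n : nat) (A : set plane) (F : plane -> plane) : Prop :=
  forall j, Ck n A (fun x => F x 0 j).

Definition smooth_onV (A : set plane) (F : plane -> plane) : Prop :=
  forall j, smooth_on A (fun x => F x 0 j).

(* D^2 F(x)(v, w), for F twice differentiable at x. *)
Definition second_diff (F : plane -> plane) (x v w : plane) : plane :=
  'D_v (fun y => 'D_w F y) x.

End Regularity.

Record chart (R : realType) (T : topologicalType) := Chart {
  dom : set T;
  coord : T -> 'rV[R]_2;
  param : 'rV[R]_2 -> T;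
  dom_open : open dom;
  cod_open : open (coord @` dom);
  coordK : forall p, dom p -> param (coord p) = p;
  coord_cont : {within dom, continuous coord};
  param_cont : {within coord @` dom, continuous param}
}.

(* Only used to pick a normal chart by global choice. *)
HB.instance Definition _ (R : realType) (T : topologicalType) :=
  gen_eqMixin (chart R T).
HB.instance Definition _ (R : realType) (T : topologicalType) :=
  gen_choiceMixin (chart R T).

Section Charts.
Variables (R : realType) (T : topologicalType).
Implicit Types u v : chart R T.

Definition cod u : set 'rV[R]_2 := coord u @` dom u.

Definition smooth_transition u v : Prop :=
  smooth_onV (coord u @` (dom u `&` dom v)) (coord v \o param u).

(* Change of frame at p, from the coordinate frame of u to that of v. *)
Definition frame_change u v (p : T) : 'M[R]_2 :=
  'J (coord v \o param u) (coord u p).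

End Charts.

(* A smooth surface without boundary.  The tangent space at p is 'rV[R]_2, a
   row vector being the tuple of components in the frame of the distinguished
   chart [chart_at p]; this only fixes a basis of T_p M. *)
Record smooth_surface (R : realType) := SmoothSurface {
  carrier :> topologicalType;
  carrier_hausdorff : hausdorff_space carrier;
  carrier_countable : second_countable (T := carrier);
  atlas : set (chart R carrier);
  atlas_smooth : forall u v, atlas u -> atlas v -> smooth_transition u v;
  chart_at : carrier -> chart R carrier;
  chart_at_atlas : forall p, atlas (chart_at p);
  chart_at_dom : forall p, dom (chart_at p) p
}.

(* Gram matrix, at the point of coordinates x in the chart u, of the metric
   with Gram matrix [g p] in the frame of [chart_at p]. *)
Definition gram_in (R : realType) (M : smooth_surface R) (g : M -> 'M[R]_2)
    (u : chart R M) (x : 'rV[R]_2) : 'M[R]_2 :=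
  let p := param u x in
  let J := frame_change u (chart_at p) p in
  J *m g p *m J^T.

Record riemannian_surface (R : realType) := RiemannianSurface {
  surface :> smooth_surface R;
  metric : surface -> 'M[R]_2;
  metric_sym : forall p, (metric p)^T = metric p;
  metric_pos : forall p (v : 'rV[R]_2),
    v != 0 -> 0 < (v *m metric p *m v^T) 0 0;
  metric_smooth : forall u, atlas u ->
    forall i j, smooth_on (cod u) (fun x => gram_in metric u x i j)
}.

Section Geometry.
Variables (R : realType) (M : riemannian_surface R).
Notation plane := 'rV[R]_2.
Implicit Types (p q : M) (v w : plane) (u : chart R M) (f : M -> M).

Definition inner p v w : R := (v *m metric p *m w^T) 0 0.

Definition tnorm p v : R := Num.sqrt (inner p v v).

(* Operator norm of A : T_p M -> T_q M. *)
Definition opnorm p q (A : 'M[R]_2) : R :=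
  sup [set tnorm q (v *m A) | v in [set v | tnorm p v = 1]].

Definition bilnorm p q (B : plane -> plane -> plane) : R :=
  sup [set r | exists v w, [/\ tnorm p v = 1, tnorm p w = 1 &
                               r = tnorm q (B v w)]].

Definition tderiv f p : 'M[R]_2 :=
  'J (coord (chart_at (f p)) \o f \o param (chart_at p))
     (coord (chart_at p) p).

(* f is C^2 in a neighbourhood of p. *)
Definition C2_at f p : Prop :=
  exists V : set M, [/\ open V, V p, V `<=` dom (chart_at p),
    (forall q, V q -> dom (chart_at (f p)) (f q)) &
    CkV 2 (coord (chart_at p) @` V)
        (coord (chart_at (f p)) \o f \o param (chart_at p))].

Definition dnorm f p : R := opnorm p (f p) (tderiv f p).

(* |det Df_p| for the Riemannian metric, i.e. with respect to orthonormal
   bases of T_p M and T_{f p} M: an orthonormal basis of T_p M has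
   determinant +-(det (metric p))^(-1/2) in the frame of [chart_at p]. *)
Definition absdet f p : R :=
  `|\det (tderiv f p)| *
  (Num.sqrt (\det (metric (f p))) / Num.sqrt (\det (metric p))).

Definition coecc f p : R :=
  (opnorm (f p) p (invmx (tderiv f p)))^-1 / dnorm f p.

Definition most_contracted f p (e : plane) : Prop :=
  tnorm p e = 1 /\
  forall v, tnorm p v = 1 ->
    tnorm (f p) (e *m tderiv f p) <= tnorm (f p) (v *m tderiv f p).

(* Christoffel symbol Gamma^k_(i j) in the chart u. *)
Definition christoffel u (i j k : 'I_2) (x : plane) : R :=
  let G := gram_in (@metric R M) u in
  let d (a b c : 'I_2) := 'D_(bvec R a) (fun y => G y b c) x in
  2^-1 * \sum_l invmx (G x) k l * (d i j l + d j i l - d l i j).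

(* Normal coordinates at p: a smooth chart centred at p with star-shaped
   image, orthonormal at p, in which each ray t |-> t *: x is a geodesic
   (the last clause is the geodesic equation c'' + Gamma(c', c') = 0 for it).
   So u is the inverse of exp_p read in an orthonormal basis of T_p M. *)
Definition normal_chart p u : Prop :=
  [/\ forall u', atlas u' -> smooth_transition u u' /\ smooth_transition u' u,
      dom u p /\ coord u p = 0,
      gram_in (@metric R M) u 0 = 1%:M,
      forall x (t : R), cod u x -> 0 <= t <= 1 -> cod u (t *: x) &
      forall x (t : R) k, cod u x -> 0 <= t <= 1 ->
        \sum_i \sum_j christoffel u i j k (t *: x) * x 0 i * x 0 j = 0].

(* Normal coordinates exist at every point and are unique, as germs, up to an
   orthogonal map, so [tderiv2] does not depend on this choice. *)
Definition normal_at p : chart R M := xget (chart_at p) (normal_chart p).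

(* D^2 f_p : T_p M x T_p M -> T_{f p} M, the second derivative computed in
   normal coordinates at p and f p. *)
Definition tderiv2 f p v w : plane :=
  let n := normal_at p in
  let n' := normal_at (f p) in
  let J := frame_change (chart_at p) n p in
  second_diff (coord n' \o f \o param n) (coord n p) (v *m J) (w *m J)
    *m frame_change n' (chart_at (f p)) (f p).

Definition d2norm f p : R := bilnorm p (f p) (tderiv2 f p).

(* The vectors e j = e^(j), 1 <= j <= k, with consistent signs. *)
Definition contracted_dirs (Phi : M -> M) (xi0 : M) (k : nat)
    (e : nat -> plane) : Prop :=
  (forall j, (1 <= j <= k)%N -> most_contracted (iter j Phi) xi0 (e j)) /\
  (forall j, (1 <= j < k)%N -> 0 <= inner xi0 (e j) (e j.+1)).

End Geometry.

Section QuasiHyperbolic.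
Variables (R : realType) (Gam Gamt lam b c ct B Bt C D : R).
Variables (M : riemannian_surface R) (Phi : M -> M) (xi0 : M) (k : nat).

Definition quasi_hyperbolic : Prop :=
  [/\ 1 <= Gamt, Num.max lam 1 < Gam, b < Gam ^+ 2 * Gamt &
  forall i, (1 <= i <= k)%N ->
    let F := iter i Phi in
    let xi := iter i.-1 Phi xi0 in
    [/\ C2_at F xi0,
        C * lam ^+ i < dnorm F xi0 /\ dnorm F xi0 < D * Gam ^+ i,
        coecc F xi0 <= B * c ^+ i /\ B * c ^+ i < 1,
        dnorm Phi xi < D * Gam * Gamt ^+ i.-1 /\
        d2norm Phi xi < D * Gam * Gamt ^+ i.-1 &
        absdet Phi xi <= b]].

Definition quasi_hyperbolic_I : Prop :=
  [/\ quasi_hyperbolic, b < lam ^+ 2 / Gamt,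
      c < lam ^+ 3 / (Gam ^+ 3 * Gamt ^+ 3) &
      lam ^+ 3 / (Gam ^+ 3 * Gamt ^+ 3) < 1].

Definition quasi_hyperbolic_II : Prop :=
  [/\ quasi_hyperbolic,
      forall i, (1 <= i <= k)%N -> Bt * ct ^+ i.-1 <= coecc Phi (iter i.-1 Phi xi0),
      b < lam ^+ 2 * ct &
      [/\ c < lam ^+ 2 * ct ^+ 2 / (Gam ^+ 2 * Gamt),
          lam ^+ 2 * ct ^+ 2 / (Gam ^+ 2 * Gamt) < ct & ct <= 1]].

(* Here Gamt = ct = 1. *)
Definition non_singular : Prop :=
  [/\ Num.max lam 1 <= Gam, b < lam ^+ 2,
      c < lam ^+ 2 / Gam ^+ 2 /\ lam ^+ 2 / Gam ^+ 2 < 1 &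
  forall i, (1 <= i <= k)%N ->
    let F := iter i Phi in
    let xi := iter i.-1 Phi xi0 in
    [/\ C2_at F xi0 /\ Bt <= coecc Phi xi,
        C * lam ^+ i < dnorm F xi0 /\ dnorm F xi0 < D * Gam ^+ i,
        coecc F xi0 < B * c ^+ i /\ B * c ^+ i < 1,
        dnorm Phi xi < D * Gam /\ d2norm Phi xi < D * Gam &
        absdet Phi xi <= b]].

End QuasiHyperbolic.

(* Main.v *)
Require Import Defs.
From HB Require Import structures.
From mathcomp Require Import all_boot all_order all_algebra.
From mathcomp Require Import all_classical all_reals all_analysis.
From mathcomp Require Import ring lra.
Set Implicit Arguments.
Unset Strict Implicit.
Unset Printing Implicit Defensive.
Import Order.TTheory GRing.Theory Num.Theory.
Import numFieldNormedType.Exports.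
Local Open Scope classical_set_scope.
Local Open Scope ring_scope.

(* Let s_j, m_j be the largest and smallest singular values of A_j = DPhi^j at
   xi_0, let T = DPhi at xi_j, so that A_(j+1) = T A_j, and let theta be the
   angle between e^(j) and e^(j+1).  As |A_(j+1) e^(j)| <= |T| m_j,
     s_(j+1) |sin theta| <= |A_(j+1) e^(j)| <= |T| m_j                     and
     s_j |sin theta| <= |A_j e^(j+1)| <= |T^-1| |A_(j+1) e^(j+1)|
                     <= |T^-1| |T| m_j.
   Since m_j = C_(xi_0, j) s_j, the first bound gives type (I) and the second
   gives type (II), after summing a geometric series from i to k.

   Only the composites Phi^j are assumed differentiable at xi_0, so the chain
   rule A_(j+1) = T A_j requires differentiability of Phi at xi_j.  It comes
   from Phi o Phi^j = Phi^(j+1) and a local right inverse of Phi^j which is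
   Lipschitz at xi_j, obtained from the invertibility of A_j. *)

(** * Strict differentiability and local inversion *)

(* Declares the join of the complete and the normed structure, which the
   library does not provide for matrices. *)
HB.instance Definition _ (R : realType) m n := Complete.on 'M[R]_(m, n).

(** * The maximum norm of matrices and differential calculus on row vectors *)

Lemma ler_coord_norm (R : realType) m n (A : 'M[R]_(m, n)) i j :
  `|A i j| <= `|A|.
Proof.
by rewrite [leRHS]/Num.Def.normr /= mx_normrE (le_bigmax _ _ (i, j)).
Qed.

Lemma mx_norm_le (R : realType) m n (A : 'M[R]_(m, n)) r :
  0 <= r -> (forall i j, `|A i j| <= r) -> `|A| <= r.
Proof.
move=> r0 Ar; rewrite [leLHS]/Num.Def.normr /= mx_normrE.
by apply: bigmax_le => // -[i j] _; exact: Ar.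
Qed.

(** The norm is the largest absolute value of an entry, and an entry of the product is a sum of [n]
    terms; hence the factor [n]. *)
Lemma mulmx_norm_le (R : realType) m n p (A : 'M[R]_(m, n)) (B : 'M[R]_(n, p)) :
  `|A *m B| <= n%:R * `|B| * `|A|.
Proof.
apply: mx_norm_le => [|i j]; first by rewrite !mulr_ge0.
rewrite mxE (le_trans (ler_norm_sum _ _ _))//.
rewrite -mulrA mulr_natl -[X in _ *+ X]card_ord -sumr_const ler_sum// => k _.
by rewrite normrM mulrC ler_pM// ler_coord_norm.
Qed.

Lemma mulmxr_continuous (R : realType) m n p (B : 'M[R]_(n, p)) :
  continuous (fun A : 'M[R]_(m, n) => A *m B).
Proof.
move=> A; apply/(@cvgrPdist_le _ _ _ _ (nbhs_filter A)) => e e0.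
have K0 : 0 < n%:R * `|B| + 1 by rewrite ltr_wpDl ?mulr_ge0.
near=> X; rewrite -mulmxBl (le_trans (mulmx_norm_le _ _))//.
rewrite (@le_trans _ _ ((n%:R * `|B| + 1) * `|A - X|)) ?ler_wpM2r ?lerDl//.
rewrite -ler_pdivlMl// mulrC; near: X; apply: (@cvgr_dist_le _ _ _ (nbhs A) _ id) => //.
by rewrite divr_gt0.
Unshelve. all: by end_near. Qed.

(** The estimates for all [e] form a little-o expansion; since [df] is continuous, uniqueness of the
    differential identifies it with [df]. *)
Lemma is_diff_near_le (R : realType) (V W : normedModType R) (f : V -> W) x
    (df : {linear V -> W}) : continuous df ->
  (forall e, 0 < e -> \forall h \near 0, `|f (h + x) - f x - df h| <= e * `|h|) ->
  is_diff x f df.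
Proof.
move=> dfc fx.
have E : f \o shift x = cst (f x) + df +o_ 0 id.
  apply/eqaddoP => e e0; near=> h.
  rewrite !fctE /= opprD addrA; near: h; exact: fx.
have dE := diff_unique dfc E.
by apply: DiffDef => //; apply/diff_locallyP; rewrite dE.
Unshelve. all: by end_near. Qed.

Lemma differentiable_near_le (R : realType) (V W : normedModType R)
    (f : V -> W) x e : differentiable f x -> 0 < e ->
  \forall h \near 0, `|f (h + x) - f x - 'd f x h| <= e * `|h|.
Proof.
move=> /diff_locally E e0.
have /eqaddoP /(_ e e0) := E.
apply: filterS => h; by rewrite !fctE /= opprD addrA.
Qed.

(** The mean value theorem on the segment from [y] to [x], which stays in the ball by convexity,
    turns the increment into a derivative at a point of the segment; there the partial derivatives
    are close to those at [x0]. *)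
Lemma strictly_differentiable_scalar (R : realType) n (g : 'rV[R]_n -> R) x0 e :
  (\forall x \near x0, differentiable g x) ->
  (forall i, {for x0, continuous (fun x => 'D_(delta_mx 0 i) g x)}) ->
  0 < e ->
  exists2 d, 0 < d & forall x y, `|x - x0| < d -> `|y - x0| < d ->
    `|g x - g y - 'D_(x - y) g x0| <= e * `|x - y|.
Proof.
(* Each of the [n] coordinates of [x - y] will contribute an error [e']; the added 1 keeps the
   denominator positive when [n] is 0. *)
move=> dg cg e0; pose e' := e / (n%:R + 1).
have e'0 : 0 < e' by rewrite divr_gt0// ltr_wpDl.
have : \forall z \near x0, differentiable g z /\ forall i,
    `|'D_(delta_mx 0 i) g x0 - 'D_(delta_mx 0 i) g z| <= e'.
  near=> z; split; first by near: z.
  by near: z; apply: filter_forall => i; apply: cvgr_dist_le => //; apply: cg.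
move=> /nbhs_ballP[d /= d0 dP]; exists d => // x y xd yd.
have {}dP z : `|z - x0| < d -> differentiable g z /\ forall i,
    `|'D_(delta_mx 0 i) g x0 - 'D_(delta_mx 0 i) g z| <= e'.
  by move=> zd; apply: dP; rewrite -ball_normE /= distrC.
pose v := x - y; pose l (t : R) := t *: v + y.
have ld (t : R) : t \in `[0, 1]%R -> `|l t - x0| < d.
  rewrite in_itv /= => /andP[t0 t1].
  have -> : l t - x0 = t *: (x - x0) + (1 - t) *: (y - x0).
    by apply/rowP => i; rewrite !mxE; ring.
  rewrite (le_lt_trans (ler_normD _ _))// !normrZ.
  rewrite (ger0_norm t0) (@ger0_norm _ (1 - t)) ?subr_ge0//.
  move: xd yd; set a := `|x - x0|; set b := `|y - x0| => ad bd.
  have [->|tn0] := eqVneq t 0; first by rewrite mul0r subr0 mul1r add0r.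
  have tp : 0 < t by rewrite lt_def tn0.
  have : t * a < t * d by rewrite ltr_pM2l.
  have : (1 - t) * b <= (1 - t) * d by rewrite ler_wpM2l ?subr_ge0// ltW.
  lra.
(* The difference quotient of [g \o l] at [t] is literally that of [g] at [l t] in the direction
   [v]. *)
have dgl (t : R) : t \in `[0, 1]%R -> is_derive t 1 (g \o l) ('D_v g (l t)).
  move=> /ld/dP[dgt _].
  have E : (fun h : R => h^-1 *: ((g \o l) (h *: 1 + t) - (g \o l) t)) =
           (fun h : R => h^-1 *: (g (h *: v + l t) - g (l t))).
    by apply/funext => h; rewrite /l /= [h *: 1]mulr1 scalerDl addrA.
  split; last by rewrite /derive E.
  by rewrite /derivable E; exact: diff_derivable.
pose dphi (t : R) : R := 'D_v g (l t).
have phic : {within `[0, 1], continuous (g \o l)}.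
  apply: derivable_within_continuous => t t01.
  by have [] := dgl t t01.
have phid (t : R) : t \in `]0, 1[%R -> is_derive t 1 (g \o l) (dphi t).
  by move=> t01; apply: dgl; exact: subset_itv_oo_cc t01.
have := MVT_segment ler01 phid phic.
move=> [t t01].
rewrite /l /= scale1r scale0r add0r subrK subr0 mulr1 => ->.
have x0d : `|x0 - x0| < d by rewrite subrr normr0.
have [dgt Dgt] := dP _ (ld _ t01).
have [dg0 _] := dP _ x0d.
have DE z : differentiable g z ->
    'D_v g z = \sum_i v 0 i * 'D_(delta_mx 0 i) g z.
  move=> dgz; rewrite deriveE// [v in LHS]row_sum_delta linear_sum.
  by apply: eq_bigr => i _; rewrite linearZ /= deriveE.
rewrite /dphi -/(l t) -/v !DE// -sumrB (le_trans (ler_norm_sum _ _ _))//.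
rewrite (@le_trans _ _ (\sum_(i < n) `|v| * e'))//.
  apply: ler_sum => i _; rewrite -mulrBr normrM ler_pM ?ler_coord_norm//.
  by rewrite distrC.
rewrite sumr_const card_ord -mulr_natr -mulrA mulrC ler_wpM2r//.
by rewrite /e' mulrAC ler_pdivrMr ?ltr_wpDl// ler_wpM2l ?lerDl ?(ltW e0).
Unshelve. all: by end_near. Qed.

Lemma differentiable_rV (R : realType) n m (F : 'rV[R]_n -> 'rV[R]_m) x :
  (forall j, differentiable (fun y => F y 0 j) x) -> differentiable F x.
Proof.
move=> dF.
have -> : F = \sum_j (fun y => F y 0 j *: delta_mx 0 j).
  by apply/funext => y; rewrite fct_sumE; exact: row_sum_delta.
by apply: differentiable_sum => j; exact: differentiableZl.
Qed.

Lemma strictly_differentiable (R : realType) n m (F : 'rV[R]_n -> 'rV[R]_m) x0 :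
  (forall j, \forall x \near x0, differentiable (fun y => F y 0 j) x) ->
  (forall i j, {for x0, continuous
     (fun x => 'D_(delta_mx 0 i) (fun y => F y 0 j) x)}) ->
  forall e, 0 < e ->
  exists2 d, 0 < d & forall x y, `|x - x0| < d -> `|y - x0| < d ->
    `|F x - F y - (x - y) *m 'J F x0| <= e * `|x - y|.
Proof.
move=> dF cF e e0.
have dFx0 : differentiable F x0.
  by apply: differentiable_rV => j; exact: nbhs_singleton (dF j).
have /choice[d dP] : forall j, exists d, 0 < d /\ forall x y,
    `|x - x0| < d -> `|y - x0| < d ->
    `|F x 0 j - F y 0 j - 'D_(x - y) (fun y => F y 0 j) x0| <= e * `|x - y|.
  move=> j.
  have [d d0 dP] := strictly_differentiable_scalar (dF j) (cF^~ j) e0.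
  by exists d.
exists (\big[Num.min/1]_j d j).
  by apply/lt_bigmin => // j _; have [] := dP j.
move=> x y xd yd.
apply: mx_norm_le => [|i j]; first by rewrite mulr_ge0 ?(ltW e0).
have [_ /(_ x y)] := dP j.
move=> /(_ (lt_le_trans xd (bigmin_le _ _ _)) (lt_le_trans yd (bigmin_le _ _ _))).
rewrite -deriveEjacobian// ord1 !mxE derive_mx ?mxE//.
exact: diff_derivable.
Qed.

(* The solution of [F x = y] is the fixed point of the simplified Newton map
   [x |-> x + (y - F x) A^-1], a contraction of the closed ball of radius
   [2 K |y - F x0|] around [x0]. *)
Lemma local_right_inverse (R : realType) n (F : 'rV[R]_n -> 'rV[R]_n) x0
    (A : 'M[R]_n) : A \in unitmx ->
  (forall e, 0 < e -> exists2 d, 0 < d & forall x y,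
     `|x - x0| < d -> `|y - x0| < d ->
     `|F x - F y - (x - y) *m A| <= e * `|x - y|) ->
  exists2 K, 0 < K & \forall y \near F x0,
    exists2 x, F x = y & `|x - x0| <= K * `|y - F x0|.
Proof.
move=> Aunit sF; pose K := n%:R * `|invmx A| + 1.
have K0 : 0 < K by rewrite ltr_wpDl ?mulr_ge0.
have KP (v : 'rV[R]_n) : `|v *m invmx A| <= K * `|v|.
  by rewrite (le_trans (mulmx_norm_le _ _))// ler_wpM2r// lerDl.
(* As [K] bounds the inverse of [A], this tolerance gives [T] the contraction ratio 1/2. *)
have [|d d0 dP] := sF (K^-1 / 2); first by rewrite divr_gt0 ?invr_gt0.
exists (2 * K); first by rewrite mulr_gt0.
have r0 : 0 < d / (2 * K) by rewrite divr_gt0 ?mulr_gt0.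
apply/nbhs_normP; exists (d / (2 * K)) => // y /= yd.
have {}yd : 2 * K * `|y - F x0| < d.
  by rewrite mulrC -ltr_pdivlMr ?mulr_gt0// distrC.
pose U := [set x | `|x0 - x| <= 2 * K * `|y - F x0|].
pose T x := x + (y - F x) *m invmx A.
have Ud x : U x -> `|x - x0| < d by move=> Ux; rewrite distrC (le_lt_trans Ux).
have Ux0 : U x0 by rewrite /U /= subrr normr0 !mulr_ge0 ?(ltW K0).
have TB u v : U u -> U v -> `|T u - T v| <= 2^-1 * `|u - v|.
  move=> /Ud ud /Ud vd.
  have -> : T u - T v = - ((F u - F v - (u - v) *m A) *m invmx A).
    rewrite mulmxBl mulmxK// opprB /T opprD addrACA -mulmxBl.
    by congr (_ + _); rewrite -mulNmx; congr (_ *m _); rewrite !opprB addrC subrKA.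
  rewrite normrN (le_trans (KP _))// (@le_trans _ _ (K * (K^-1 / 2 * `|u - v|)))//.
    by rewrite ler_wpM2l ?(ltW K0)// dP.
  by rewrite !mulrA mulfV ?gt_eqF// mul1r.
(* The distance from [T x] to [x0] is at most half that from [x] to [x0] plus K |y - F x0|; a radius
   of twice the last term is therefore preserved. *)
have TU : {homo T : x / U x >-> U x}.
  move=> x Ux; rewrite /U /= distrC.
  have -> : T x - x0 = (T x - T x0) + (y - F x0) *m invmx A.
    by rewrite /T opprD addrA subrK.
  rewrite (le_trans (ler_normD _ _))//.
  have := TB _ _ Ux Ux0; have := KP (y - F x0); move: Ux.
  rewrite /U /= (distrC x0); lra.
have Tctr : is_contraction (mkfun_fun TU).
  exists (2^-1)%:nng; split => /=; first by rewrite invf_lt1// ltr1n.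
  by move=> [u v] [/= Uu Uv]; exact: TB.
have [||x Ux xE] := banach_fixed_point Tctr.
- exact: closed_closed_ball_.
- by exists x0.
- exists x; last by rewrite distrC.
  have {}xE : x = T x := xE.
  have : (y - F x) *m invmx A = 0.
    by apply: (addrI x); rewrite addr0; exact: esym xE.
  by move=> /(congr1 (mulmx^~ A)); rewrite mulmxKV// mul0mx => /subr0_eq.
Qed.

(** A small increment [h] is realised as F x - F x0 with |x - x0| <= K |h|. Then H (F x0 + h) = G x,
    whose increment is close to (x - x0) B, while [h] is close to (x - x0) A. *)
Lemma is_diff_factor (R : realType) n m (F : 'rV[R]_n -> 'rV[R]_n)
    (G H : 'rV[R]_n -> 'rV[R]_m) x0 :
  'J F x0 \in unitmx ->
  (forall e, 0 < e -> exists2 d, 0 < d & forall x y,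
     `|x - x0| < d -> `|y - x0| < d ->
     `|F x - F y - (x - y) *m 'J F x0| <= e * `|x - y|) ->
  differentiable G x0 ->
  (\forall x \near x0, H (F x) = G x) ->
  is_diff (F x0) H (mulmxr (invmx ('J F x0) *m 'J G x0)).
Proof.
move=> Aunit sF dG HF; set A := 'J F x0; set B := 'J G x0.
have [K K0 KP] := local_right_inverse Aunit sF.
apply: is_diff_near_le => [|e e0]; first exact: mulmxr_continuous.
pose L := n%:R * `|invmx A *m B| + 1.
have L0 : 0 < L by rewrite ltr_wpDl ?mulr_ge0.
have LP (v : 'rV[R]_n) : `|v *m (invmx A *m B)| <= L * `|v|.
  by rewrite (le_trans (mulmx_norm_le _ _))// ler_wpM2r// lerDl.
(* The error of [F] is amplified by [L] and that of [G] is not; both are measured in x - x0, which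
   costs a factor [K]. Each then contributes half of [e]. *)
have [|d1 d10 d1P] := sF (e / 2 / (L * K)).
  by rewrite !divr_gt0 ?mulr_gt0.
have e1 : 0 < e / 2 / K by rewrite !divr_gt0.
have /nbhs_norm0P[d2 /= d20 d2P] := differentiable_near_le dG e1.
have /nbhs_normP[d3 /= d30 d3P] := HF.
have /nbhs_normP[d4 /= d40 d4P] := KP.
have [d [d0 dd1 dd2 dd3]] : exists d, [/\ 0 < d, d <= d1, d <= d2 & d <= d3].
  exists (Num.min d1 (Num.min d2 d3)).
  by rewrite !lt_min !ge_min d10 d20 d30 !lexx ?orbT.
apply/nbhs_norm0P; exists (Num.min d4 (d / K)).
  by rewrite /= lt_min d40 divr_gt0.
move=> h /=; rewrite lt_min => /andP[hd4 hd].
have [|x Fx] := d4P (h + F x0).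
  by rewrite /= opprD addrCA subrr addr0 normrN.
rewrite addrK => xh.
have xd : `|x - x0| < d.
  by rewrite (le_lt_trans xh)// mulrC -ltr_pdivlMr.
rewrite -Fx d3P; last by rewrite /= distrC (lt_le_trans xd).
rewrite (nbhs_singleton HF).
have := d2P (x - x0); rewrite subrK => /(_ (lt_le_trans xd dd2)).
have := d1P x x0; rewrite subrr normr0 => /(_ (lt_le_trans xd dd1) d10).
rewrite Fx addrK -/A => hA.
have -> : 'd G x0 (x - x0) = (x - x0) *m B by rewrite mul_rV_lin1.
move=> GB.
have -> : G x - G x0 - mulmxr (invmx A *m B) h = (G x - G x0 - (x - x0) *m B) -
    (h - (x - x0) *m A) *m (invmx A *m B).
  by rewrite [(h - _) *m _]mulmxBl [_ *m A *m _]mulmxA mulmxK// opprB addrA subrK.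
rewrite (le_trans (ler_normB _ _))// (splitr e) mulrDl lerD//.
  rewrite (le_trans GB)// (le_trans (ler_wpM2l (ltW e1) xh))//.
  by rewrite mulrA divfK ?gt_eqF.
have e2 : 0 < e / 2 / (L * K) by rewrite !divr_gt0 ?mulr_gt0.
rewrite (le_trans (LP _))// (le_trans (ler_wpM2l (ltW L0) hA))//.
rewrite (le_trans (ler_wpM2l (ltW L0) (ler_wpM2l (ltW e2) xh)))//.
suff -> : L * (e / 2 / (L * K) * (K * `|h|)) = e / 2 * `|h| by [].
by field; rewrite !gt_eqF.
Qed.

(** * The chain rule along an orbit *)

(** Inside the open image of the chart, the image of [V] is the preimage of [V] under the continuous
    map [param u]. *)
Lemma open_coord_image (R : realType) (T : topologicalType) (u : chart R T)
    (V : set T) : open V -> V `<=` dom u -> open (Defs.coord u @` V).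
Proof.
move=> oV Vu.
have -> : Defs.coord u @` V = Defs.coord u @` dom u `&` param u @^-1` V.
  apply/seteqP; split => [_ [q Vq <-]|_ [[q uq <-]]] /=.
    by split; [exists q => //; exact: Vu|rewrite coordK//; exact: Vu].
  by rewrite coordK// => Vq; exists q.
rewrite openE => x [ux Vx].
have cx : {for x, continuous (param u)}.
  have := @param_cont _ _ u; rewrite continuous_open_subspace; last exact: cod_open.
  by apply; rewrite inE.
apply: filterI; first by apply: open_nbhs_nbhs; split => //; exact: cod_open.
by apply: cx; exact: open_nbhs_nbhs.
Qed.

(** In charts, [F], [G] and [H] represent [Psi], the composite and [Phi]. The relation H (F x) = G x
    near [x0] yields both the differentiability of [H] and its Jacobian. *)
Lemma tderiv_comp (R : realType) (M : riemannian_surface R) (Phi Psi : M -> M)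
    (p : M) :
  C2_at Psi p -> C2_at (Phi \o Psi) p -> tderiv Psi p \in unitmx ->
  tderiv (Phi \o Psi) p = tderiv Psi p *m tderiv Phi (Psi p).
Proof.
move=> [V [oV Vp Vd VPsi CPsi]] [W [oW Wp Wd _ CPhi]] Psiu.
pose c0 := chart_at p; pose c1 := chart_at (Psi p).
pose c2 := chart_at (Phi (Psi p)).
pose F := Defs.coord c1 \o Psi \o param c0.
pose G := Defs.coord c2 \o (Phi \o Psi) \o param c0.
pose H := Defs.coord c2 \o Phi \o param c1.
pose x0 := Defs.coord c0 p.
have near_image U : open U -> U p -> U `<=` dom c0 -> nbhs x0 (Defs.coord c0 @` U).
  move=> oU Up Ud; apply: open_nbhs_nbhs; split; last by exists p.
  exact: open_coord_image.
have Vx0 := near_image _ oV Vp Vd.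
have Wx0 := near_image _ oW Wp Wd.
have Fx0 : F x0 = Defs.coord c1 (Psi p) by rewrite /F /= coordK//; exact: Vd.
have dG : differentiable G x0.
  apply: differentiable_rV => j; apply: (CPhi j).1.
  exact: nbhs_singleton Wx0.
have sF : forall e, 0 < e -> exists2 d, 0 < d & forall x y,
     `|x - x0| < d -> `|y - x0| < d ->
     `|F x - F y - (x - y) *m 'J F x0| <= e * `|x - y|.
  apply: strictly_differentiable => [j|i j].
    by apply: filterS Vx0; exact: (CPsi j).1.
  (* Second order regularity makes the first partial derivatives differentiable, hence
     continuous. *)
  apply: differentiable_continuous; apply: ((CPsi j).2 i).1.
  exact: nbhs_singleton Vx0.
have HF : \forall x \near x0, H (F x) = G x.
  apply: filterS Vx0 => _ [q Vq <-].
  by rewrite /H /F /G /= (coordK (Vd _ Vq)) coordK//; exact: VPsi.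
have [_ dH] := is_diff_factor Psiu sF dG HF.
have JH : 'J H (F x0) = invmx ('J F x0) *m 'J G x0.
  by apply/row_matrixP => i; rewrite !rowE mul_rV_lin1 dH.
rewrite /tderiv -/c0 -/c1 -/c2 -/x0 -Fx0.
by rewrite -/F -/G -/H JH mulKVmx.
Qed.

(** * Singular directions of maps between tangent planes *)

Section TangentPlane.
Variables (R : realType) (M : riemannian_surface R).
Notation plane := 'rV[R]_2.
Implicit Types (p q r : M) (u v w e f : plane) (A T : 'M[R]_2).

(** * Euclidean geometry of a tangent plane *)

Lemma innerC p v w : inner p v w = inner p w v.
Proof.
rewrite /inner -[in LHS](trmxK (v *m _ *m _)) [LHS]mxE.
by rewrite trmx_mul trmxK trmx_mul Defs.metric_sym mulmxA.
Qed.

Lemma innerDl p u v w : inner p (u + v) w = inner p u w + inner p v w.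
Proof. by rewrite /inner !mulmxDl mxE. Qed.

Lemma innerZl p a v w : inner p (a *: v) w = a * inner p v w.
Proof. by rewrite /inner -!scalemxAl mxE. Qed.

Lemma innerNl p v w : inner p (- v) w = - inner p v w.
Proof. by rewrite -scaleN1r innerZl mulN1r. Qed.

Lemma innerDr p u v w : inner p u (v + w) = inner p u v + inner p u w.
Proof. by rewrite innerC innerDl !(innerC p u). Qed.

Lemma innerZr p a v w : inner p v (a *: w) = a * inner p v w.
Proof. by rewrite innerC innerZl innerC. Qed.

Lemma innerNr p v w : inner p v (- w) = - inner p v w.
Proof. by rewrite innerC innerNl innerC. Qed.

Definition innerE := (innerDl, innerDr, innerZl, innerZr, innerNl, innerNr).

Lemma inner_gt0 p v : v != 0 -> 0 < inner p v v.
Proof. exact: Defs.metric_pos. Qed.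

Lemma inner_ge0 p v : 0 <= inner p v v.
Proof.
have [->|/inner_gt0/ltW//] := eqVneq v 0.
by rewrite /inner !mul0mx mxE.
Qed.

Lemma tnorm_ge0 p v : 0 <= tnorm p v.
Proof. exact: sqrtr_ge0. Qed.

Lemma tnorm_gt0 p v : v != 0 -> 0 < tnorm p v.
Proof. by move=> v0; rewrite sqrtr_gt0 inner_gt0. Qed.

Lemma sqr_tnorm p v : tnorm p v ^+ 2 = inner p v v.
Proof. by rewrite sqr_sqrtr ?inner_ge0. Qed.

Lemma tnormZ p a v : tnorm p (a *: v) = `|a| * tnorm p v.
Proof.
by rewrite /tnorm innerZl innerZr mulrA -expr2 sqrtrM ?sqr_ge0// sqrtr_sqr.
Qed.

Lemma tnormN p v : tnorm p (- v) = tnorm p v.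
Proof. by rewrite -scaleN1r tnormZ normrN normr1 mul1r. Qed.

Lemma tnorm0 p : tnorm p 0 = 0.
Proof. by rewrite -[0](scale0r 0) tnormZ normr0 mul0r. Qed.

Lemma tnorm1_neq0 p v : tnorm p v = 1 -> v != 0.
Proof. by apply: contra_eq_neq => ->; rewrite tnorm0 eq_sym oner_neq0. Qed.

Lemma tnorm_normalize p v : v != 0 -> tnorm p ((tnorm p v)^-1 *: v) = 1.
Proof.
move=> /(tnorm_gt0 p) v0.
by rewrite tnormZ ger0_norm ?invr_ge0 ?ltW// mulVf ?gt_eqF.
Qed.

Lemma tnormD p v w : tnorm p (v + w) <= tnorm p v + tnorm p w.
Proof.
have [->|v0] := eqVneq v 0; first by rewrite tnorm0 !add0r.
have [->|w0] := eqVneq w 0; first by rewrite tnorm0 !addr0.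
have vp := tnorm_gt0 p v0; have wp := tnorm_gt0 p w0.
rewrite -ler_sqr ?nnegrE ?addr_ge0 ?tnorm_ge0// sqrrD !sqr_tnorm !innerE.
(* Expanding this square gives the Cauchy-Schwarz inequality, multiplied by the product of the two
   norms. *)
have := inner_ge0 p (tnorm p w *: v - tnorm p v *: w).
rewrite !innerE -!sqr_tnorm !(innerC p w v) => vw.
have : tnorm p v * tnorm p w * inner p v w <=
       tnorm p v * tnorm p w * (tnorm p v * tnorm p w).
  by move: vw; nra.
rewrite ler_pM2l ?mulr_gt0// => CS.
by rewrite -mulr_natr; lra.
Qed.

(** A quarter turn of the covector [g] representing the pairing with [e] gives a vector orthogonal
    to [e] for the metric; [f] is its normalisation. *)
Lemma orthonormal_frame p e : tnorm p e = 1 ->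
  exists f, [/\ tnorm p f = 1, inner p e f = 0 &
    forall v, v = inner p v e *: e + inner p v f *: f].
Proof.
move=> e1; have [g gE] : exists g, g = e *m Defs.metric p by exists (e *m Defs.metric p).
have g0 : g != 0.
  apply/eqP => g0; have /(inner_gt0 p) := tnorm1_neq0 e1.
  by rewrite /inner -gE g0 mul0mx mxE ltxx.
pose w : plane := \row_j (if j == 0 then - g 0 1 else g 0 0).
have ew : inner p e w = 0.
  rewrite /inner -gE mxE !big_ord_recl big_ord0 !mxE /=.
  have -> : lift 0 0 = 1 :> 'I_2 by apply/val_inj.
  rewrite /=; ring.
have w0 : w != 0.
  apply: contra_neq g0 => w0; apply/rowP => j; rewrite mxE.
  have := congr1 (fun M : plane => M 0 0) w0; rewrite !mxE /= => /eqP.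
  rewrite oppr_eq0 => /eqP g01.
  have := congr1 (fun M : plane => M 0 1) w0; rewrite !mxE /= => g00.
  case: j => -[|[|//]] j2; [rewrite -[RHS]g00|rewrite -[RHS]g01];
    by congr (g _ _); exact: val_inj.
pose f := (tnorm p w)^-1 *: w; have f1 : tnorm p f = 1 by exact: tnorm_normalize.
have ef : inner p e f = 0 by rewrite innerZr ew mulr0.
exists f; split=> // v.
pose E := \matrix_(i < 2) if i == 0 then e else f.
have E0 : row 0 E = e by rewrite rowK.
have E1 : row 1 E = f by rewrite rowK.
have EGE (i : 'I_2) u : (u *m (Defs.metric p *m E^T)) 0 i = inner p u (row i E).
  rewrite /inner mulmxA !mxE; apply: eq_bigr => k _; by rewrite !mxE.
(* Orthonormality says that [E] times (metric times E^T) is the identity. Commuting the two square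
   factors gives the expansion of every vector in the frame. *)
have /mulmx1C GE : E *m (Defs.metric p *m E^T) = 1%:M.
  apply/matrixP => i j.
  have -> : (E *m (Defs.metric p *m E^T)) i j = inner p (row i E) (row j E).
    by rewrite -EGE -row_mul [RHS]mxE.
  have rE k : row k E = if k == 0 then e else f by rewrite rowK.
  rewrite !rE mxE.
  case: i j => -[|[|//]] i2 [[|[|//]] j2] /=.
  - by rewrite -sqr_tnorm e1 expr1n.
  - by rewrite ef.
  - by rewrite innerC ef.
  - by rewrite -sqr_tnorm f1 expr1n.
rewrite -[LHS]mulmx1 -GE mulmxA mulmx_sum_row !big_ord_recl big_ord0 addr0.
have -> : lift 0 0 = 1 :> 'I_2 by apply/val_inj.
by rewrite !EGE E0 E1.
Qed.

Lemma parseval p e f v : tnorm p e = 1 -> tnorm p f = 1 -> inner p e f = 0 ->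
  v = inner p v e *: e + inner p v f *: f ->
  tnorm p v ^+ 2 = inner p v e ^+ 2 + inner p v f ^+ 2.
Proof.
move=> e1 f1 ef; set a := inner p v e; set b := inner p v f => ->.
rewrite sqr_tnorm !innerE (innerC p f e) ef -!sqr_tnorm e1 f1; ring.
Qed.

(** With cosine x >= 0, the squared distance is 2 (1 - x), at most 4 (1 - x) (1 + x), which is four
    times the squared sine. The sign convention on the directions enters here. *)
Lemma tnorm_sub_unit p e e' f : tnorm p e = 1 -> tnorm p e' = 1 ->
  0 <= inner p e e' ->
  inner p e e' ^+ 2 + inner p e' f ^+ 2 = 1 ->
  tnorm p (e' - e) <= 2 * `|inner p e' f|.
Proof.
move=> e1 e'1 ee' cs.
rewrite -ler_sqr ?nnegrE ?mulr_ge0 ?tnorm_ge0// sqr_tnorm !innerE.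
rewrite -!sqr_tnorm e1 e'1 (innerC p e' e) exprMn real_normK ?num_real//.
by move: ee' cs; nra.
Qed.

(** [K] certifies that the set defining [opnorm] is bounded; the supremum of an unbounded set has
    the default value 0. *)
Lemma opnorm_ub p q A K v :
  (forall w, tnorm q (w *m A) <= K * tnorm p w) ->
  tnorm q (v *m A) <= opnorm p q A * tnorm p v.
Proof.
move=> AK; have [->|v0] := eqVneq v 0.
  by rewrite mul0mx !tnorm0 mulr0.
rewrite -ler_pdivrMr ?tnorm_gt0//; apply: ub_le_sup.
  by exists K => _ [w /= w1 <-]; rewrite (le_trans (AK w))// w1 mulr1.
exists ((tnorm p v)^-1 *: v) => /=; first exact: tnorm_normalize.
by rewrite -scalemxAl tnormZ mulrC ger0_norm ?invr_ge0 ?tnorm_ge0.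
Qed.

Lemma opnorm_le p q A K :
  (forall w, tnorm p w = 1 -> tnorm q (w *m A) <= K) -> opnorm p q A <= K.
Proof.
move=> AK; apply: ge_sup; last by move=> _ [w /= w1 <-]; exact: AK.
have v0 : delta_mx 0 0 != 0 :> plane.
  by apply/eqP => /rowP/(_ 0)/eqP; rewrite !mxE !eqxx oner_eq0.
by eexists; exists ((tnorm p (delta_mx 0 0))^-1 *: delta_mx 0 0) => //=;
  exact: tnorm_normalize.
Qed.

Lemma opnorm_ge0 p q A : 0 <= opnorm p q A.
Proof.
rewrite /opnorm; set S := [set _ | _ in _].
have [[[x Sx] ubS]|/sup_out ->//] := pselect (has_sup S).
apply: (@le_trans _ _ x); last exact: ub_le_sup.
by case: Sx => v _ <-; exact: tnorm_ge0.
Qed.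

(* [most_contracted] for an arbitrary linear map T_p M -> T_q M. *)
Definition contracted p q A e := tnorm p e = 1 /\
  forall v, tnorm p v = 1 -> tnorm q (e *m A) <= tnorm q (v *m A).

Lemma contracted_le p q A e v : contracted p q A e ->
  tnorm q (e *m A) * tnorm p v <= tnorm q (v *m A).
Proof.
move=> [_ eA]; have [->|v0] := eqVneq v 0.
  by rewrite mul0mx !tnorm0 mulr0.
rewrite -ler_pdivlMr ?tnorm_gt0//.
rewrite (le_trans (eA _ (tnorm_normalize p v0)))//.
by rewrite -scalemxAl tnormZ mulrC ger0_norm ?invr_ge0 ?tnorm_ge0.
Qed.

(* First variation of the quotient [tnorm q (v *m A) / tnorm p v] at [e]. *)
Lemma contracted_orthogonal p q A e f : contracted p q A e ->
  inner p e f = 0 -> inner q (e *m A) (f *m A) = 0.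
Proof.
move=> eA ef; have [e1 _] := eA.
have [m mE] : exists m, m = tnorm q (e *m A) by exists (tnorm q (e *m A)).
have pos t : 0 <= 2 * t * inner q (e *m A) (f *m A) + t ^+ 2 *
    (tnorm q (f *m A) ^+ 2 - m ^+ 2 * tnorm p f ^+ 2).
  have ht : (m * tnorm p (e + t *: f)) ^+ 2 <=
      tnorm q ((e + t *: f) *m A) ^+ 2.
    by rewrite lerXn2r ?nnegrE ?mulr_ge0 ?tnorm_ge0// mE ?tnorm_ge0 ?contracted_le.
  move: ht; rewrite exprMn !(sqr_tnorm _ (_ + _)) mulmxDl -scalemxAl sqr_tnorm.
  rewrite !innerE (innerC p f e) ef (innerC q (f *m A)) -!sqr_tnorm -mE e1; lra.
move: pos; set x := inner q _ _; set y := _ - _ => pos.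
apply/eqP; rewrite -sqrf_eq0 eq_le sqr_ge0 andbT leNgt; apply/negP => x0.
have n0 : 0 < `|y| + 1 by rewrite ltr_wpDl.
(* At this [t] the quadratic expression equals a positive multiple of y - 2 (|y| + 1), which is
   negative. *)
have := pos (- x / (`|y| + 1)).
have -> : 2 * (- x / (`|y| + 1)) * x + (- x / (`|y| + 1)) ^+ 2 * y =
    x ^+ 2 / (`|y| + 1) ^+ 2 * (y - 2 * (`|y| + 1)).
  by field; rewrite gt_eqF.
rewrite pmulr_rge0; last by rewrite divr_gt0// exprn_gt0.
by have := ler_norm y; have := normr_ge0 y; lra.
Qed.

Lemma contracted_frame p q A e f v : contracted p q A e ->
  tnorm p f = 1 -> inner p e f = 0 -> v = inner p v e *: e + inner p v f *: f ->
  tnorm q (v *m A) ^+ 2 = inner p v e ^+ 2 * tnorm q (e *m A) ^+ 2 +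
                          inner p v f ^+ 2 * tnorm q (f *m A) ^+ 2.
Proof.
move=> eA f1 ef; set a := inner p v e; set b := inner p v f => ->.
rewrite mulmxDl -!scalemxAl sqr_tnorm !innerE (innerC q (f *m A)).
by rewrite (contracted_orthogonal eA ef) -!sqr_tnorm; ring.
Qed.

(** The orthogonal pair [e], [f] has orthogonal images, so [f] is a most expanded direction and its
    image has norm [opnorm p q A]. Dropping the component along [e] gives the last bound. *)
Lemma contracted_opnorm p q A e : contracted p q A e ->
  exists f, [/\ tnorm p f = 1, inner p e f = 0,
    forall v, tnorm p v ^+ 2 = inner p v e ^+ 2 + inner p v f ^+ 2,
    forall v, tnorm q (v *m A) <= opnorm p q A * tnorm p v &
    forall v, `|inner p v f| * opnorm p q A <= tnorm q (v *m A)].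
Proof.
move=> eA; have [e1 eAm] := eA.
have [f [f1 ef fr]] := orthonormal_frame e1.
have vE v : tnorm p v ^+ 2 = inner p v e ^+ 2 + inner p v f ^+ 2.
  exact: parseval.
have vAE v := contracted_frame eA f1 ef (fr v).
have bd v : tnorm q (v *m A) <= tnorm q (f *m A) * tnorm p v.
  rewrite -ler_sqr ?nnegrE ?mulr_ge0 ?tnorm_ge0// exprMn vAE vE.
  rewrite mulrDr addrC [leRHS]addrC lerD//; first by rewrite mulrC.
  by rewrite mulrC ler_wpM2r ?sqr_ge0// ler_sqr ?nnegrE ?tnorm_ge0// eAm.
exists f; split => // v; first exact: opnorm_ub bd.
apply: (@le_trans _ _ (`|inner p v f| * tnorm q (f *m A))).
  by rewrite ler_wpM2l// opnorm_le// => w w1; rewrite (le_trans (bd w))// w1 mulr1.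
rewrite -ler_sqr ?nnegrE ?mulr_ge0 ?tnorm_ge0// exprMn (vAE v).
by rewrite real_normK ?num_real// lerDr mulr_ge0 ?sqr_ge0.
Qed.

Lemma contracted_gt0 p q A e : contracted p q A e -> A \in unitmx ->
  0 < tnorm q (e *m A).
Proof.
move=> [e1 _] Au; rewrite tnorm_gt0//; apply: contra_neq (tnorm1_neq0 e1) => eA.
by rewrite -(mulmxK Au e) eA mul0mx.
Qed.

Lemma contracted_inv p q A e w : contracted p q A e -> A \in unitmx ->
  tnorm p (w *m invmx A) <= (tnorm q (e *m A))^-1 * tnorm q w.
Proof.
move=> eA Au; rewrite mulrC ler_pdivlMr ?(contracted_gt0 eA)//.
by have := contracted_le (w *m invmx A) eA; rewrite mulmxKV// mulrC.
Qed.

Lemma opnorm_gt0 p q A K : A \in unitmx ->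
  (forall v, tnorm q (v *m A) <= K * tnorm p v) -> 0 < opnorm p q A.
Proof.
move=> Au AK.
have v0 : delta_mx 0 0 != 0 :> plane.
  by apply/eqP => /rowP/(_ 0)/eqP; rewrite !mxE !eqxx oner_eq0.
rewrite -(pmulr_lgt0 _ (tnorm_gt0 p v0)) (lt_le_trans _ (opnorm_ub _ AK))//.
by rewrite tnorm_gt0//; apply: contra_neq v0 => vA;
  rewrite -(mulmxK Au (delta_mx 0 0)) vA mul0mx.
Qed.

(** The smallest stretch is at most the reciprocal norm of the inverse. The right side is left
    unsimplified so as to read as co-eccentricity times norm. *)
Lemma contracted_coecc p q A e : contracted p q A e -> A \in unitmx ->
  tnorm q (e *m A) <= (opnorm q p (invmx A))^-1 / opnorm p q A * opnorm p q A.
Proof.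
move=> eA Au; have m0 := contracted_gt0 eA Au.
have [f [_ _ _ AK _]] := contracted_opnorm eA.
have iu : invmx A \in unitmx by rewrite unitmx_inv.
have i0 := opnorm_gt0 iu (fun w => contracted_inv w eA Au).
rewrite divfK; last by rewrite gt_eqF// (opnorm_gt0 Au AK).
rewrite -[leLHS]invrK lef_pV2 ?posrE ?invr_gt0//.
by apply: opnorm_le => w w1; rewrite (le_trans (contracted_inv w eA Au))// w1 mulr1.
Qed.

(* Both estimates compare [e], contracted by [A], with [e'], contracted by
   [A *m T]: the first tests the component of [e] on the expanded direction of
   [A *m T], the second that of [e'] on the expanded direction of [A]. *)
Lemma contracted_step p q r A T e e' :
  contracted p q A e -> contracted p r (A *m T) e' -> A \in unitmx ->
  A *m T \in unitmx -> 0 <= inner p e e' ->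
  tnorm p (e' - e) * opnorm p r (A *m T) <=
    2 * (opnorm q r T * tnorm q (e *m A)) /\
  tnorm p (e' - e) * opnorm p q A <=
    2 * (opnorm q r T * opnorm r q (invmx T) * tnorm q (e *m A)).
Proof.
move=> eA eAT Au ATu ee'; have [e1 _] := eA; have [e'1 e'm] := eAT.
have Tu : T \in unitmx by move: ATu; rewrite unitmx_mul => /andP[].
have [f [f1 ef fE Abd fA]] := contracted_opnorm eA.
have [f' [f'1 ef' f'E ATbd f'A]] := contracted_opnorm eAT.
have Abd0 := opnorm_gt0 Au Abd; have ATbd0 := opnorm_gt0 ATu ATbd.
(* This bound and the next one only ensure that the suprema defining the norms of [T] and its
   inverse are finite; their constants disappear. *)
have Tbd w : tnorm r (w *m T) <=
    opnorm p r (A *m T) * (tnorm q (e *m A))^-1 * tnorm q w.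
  have := ATbd (w *m invmx A); rewrite mulmxA mulmxKV// => /le_trans; apply.
  by rewrite -mulrA ler_wpM2l ?(ltW ATbd0)// contracted_inv.
have TVbd w : tnorm q (w *m invmx T) <=
    opnorm p q A * (tnorm r (e' *m (A *m T)))^-1 * tnorm r w.
  have -> : w *m invmx T = w *m invmx (A *m T) *m A.
    by rewrite -[RHS](mulmxK Tu) -(mulmxA _ A T) mulmxKV.
  rewrite (le_trans (Abd _))// -mulrA ler_wpM2l ?(ltW Abd0)//.
  exact: contracted_inv.
have eT : tnorm r (e *m (A *m T)) <= opnorm q r T * tnorm q (e *m A).
  by rewrite mulmxA; exact: opnorm_ub Tbd.
split.
  have -> : tnorm p (e' - e) = tnorm p (e - e') by rewrite -opprB tnormN.
  have : tnorm p (e - e') <= 2 * `|inner p e f'|.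
    by apply: tnorm_sub_unit => //; [rewrite innerC|rewrite innerC -f'E e1 expr1n].
  move=> /(ler_wpM2r (ltW ATbd0)) /le_trans; apply.
  by rewrite -mulrA ler_wpM2l// (le_trans (f'A e)).
have : tnorm p (e' - e) <= 2 * `|inner p e' f|.
  by apply: tnorm_sub_unit => //; rewrite innerC -fE e'1 expr1n.
move=> /(ler_wpM2r (ltW Abd0)) /le_trans; apply.
rewrite -[leLHS]mulrA ler_wpM2l// (le_trans (fA e'))//.
have -> : e' *m A = e' *m (A *m T) *m invmx T by rewrite mulmxA mulmxK.
rewrite (le_trans (opnorm_ub _ TVbd))// mulrAC [leRHS]mulrC ler_wpM2l//.
  by rewrite ltW// (opnorm_gt0 _ TVbd)// unitmx_inv.
by rewrite (le_trans (e'm e e1)).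
Qed.

End TangentPlane.

(** * Accumulated rotation of the contracted directions *)

(** The chain rule applies [contracted_step] to the derivatives at times [j] and [j.+1]; the
    smallest stretch is then replaced by co-eccentricity times norm. *)
Lemma contracted_dirs_step (R : realType) (M : riemannian_surface R)
    (Phi : M -> M) (xi0 : M) (k j : nat) (e : nat -> 'rV[R]_2) :
  (1 <= j < k)%N ->
  (forall i, (1 <= i <= k)%N -> C2_at (iter i Phi) xi0) ->
  (forall i, (1 <= i <= k)%N -> tderiv (iter i Phi) xi0 \in unitmx) ->
  contracted_dirs Phi xi0 k e ->
  tnorm xi0 (e j.+1 - e j) * dnorm (iter j.+1 Phi) xi0 <=
    2 * (dnorm Phi (iter j Phi xi0) *
         (coecc (iter j Phi) xi0 * dnorm (iter j Phi) xi0)) /\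
  (0 < coecc Phi (iter j Phi xi0) ->
   tnorm xi0 (e j.+1 - e j) * coecc Phi (iter j Phi xi0) <=
     2 * coecc (iter j Phi) xi0).
Proof.
move=> /andP[j1 jk] C2 unit [mc sgn].
have jk' : (1 <= j <= k)%N by rewrite j1 ltnW.
have Sjk : (1 <= j.+1 <= k)%N by [].
pose A := tderiv (iter j Phi) xi0; pose T := tderiv Phi (iter j Phi xi0).
have AT : tderiv (iter j.+1 Phi) xi0 = A *m T.
  by apply: (@tderiv_comp _ _ Phi (iter j Phi)); 
    [exact: (C2 _ jk')|exact: (C2 _ Sjk)|exact: (unit _ jk')].
have Au : A \in unitmx := unit _ jk'.
have ATu : A *m T \in unitmx by rewrite -AT; exact: (unit _ Sjk).
have eA : contracted xi0 (iter j Phi xi0) A (e j) := mc _ jk'.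
have eAT : contracted xi0 (iter j.+1 Phi xi0) (A *m T) (e j.+1).
  by have := mc _ Sjk; rewrite /most_contracted AT.
have ee : 0 <= inner xi0 (e j) (e j.+1) by apply: sgn; rewrite j1.
have [s1 s2] := contracted_step eA eAT Au ATu ee.
have m_le : tnorm (iter j Phi xi0) (e j *m A) <=
    coecc (iter j Phi) xi0 * dnorm (iter j Phi) xi0 := contracted_coecc eA Au.
have [_ [_ _ _ /(opnorm_gt0 Au) s0 _]] := contracted_opnorm eA.
have {}s0 : 0 < dnorm (iter j Phi) xi0 := s0.
have Sn : dnorm (iter j.+1 Phi) xi0 = opnorm xi0 (iter j.+1 Phi xi0) (A *m T).
  by rewrite /dnorm AT.
split=> [|co].
  rewrite Sn; apply: (le_trans s1); apply: ler_wpM2l; first exact: ler0n.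
  by apply: ler_wpM2l m_le; exact: opnorm_ge0.
(* Here [s] is the norm at time [j], [b] and [a] are the norms of [T] and its inverse; positivity of
   their co-eccentricity makes both nonzero, so denominators clear. *)
have ratio (x s a b m kap : R) : 0 < s -> 0 < a^-1 / b ->
    x * s <= 2 * (b * a * m) -> m <= kap * s -> x * (a^-1 / b) <= 2 * kap.
  move=> s'0 ab xs ms; rewrite -(ler_pM2r s'0) -[leRHS]mulrA mulrAC.
  move: (lt0r_neq0 ab); rewrite mulf_eq0 !invr_eq0 negb_or => /andP[a0 b0].
  rewrite (le_trans (ler_wpM2r (ltW ab) xs))// -[leLHS]mulrA ler_wpM2l//.
  by rewrite (_ : _ * (a^-1 / b) = m)//; field; rewrite a0 b0.
exact: ratio s0 co s2 m_le.
Qed.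

Lemma telescope_geometric (R : realType) (M : riemannian_surface R) (p : M)
    (e : nat -> 'rV[R]_2) (K q : R) (i k : nat) :
  0 <= K -> 0 <= q < 1 -> (i <= k)%N ->
  (forall j, (i <= j < k)%N -> tnorm p (e j.+1 - e j) <= K * q ^+ j) ->
  tnorm p (e k - e i) <= K / (1 - q) * q ^+ i.
Proof.
move=> K0 /andP[q0 q1] ik step; have q1' : 0 < 1 - q by rewrite subr_gt0.
(* The sharper bound makes the induction exact: passing from [k] to [k.+1] adds precisely K q^k. *)
suff : tnorm p (e k - e i) <= K / (1 - q) * (q ^+ i - q ^+ k).
  move=> /le_trans; apply; rewrite ler_wpM2l ?divr_ge0 ?(ltW q1')//.
  by rewrite gerBl exprn_ge0.
elim: k ik step => [|k IH].
  by rewrite leqn0 => /eqP -> _; rewrite !subrr mulr0 tnorm0.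
rewrite leq_eqVlt => /predU1P[<- _|ik step].
  by rewrite !subrr mulr0 tnorm0.
have -> : e k.+1 - e i = (e k.+1 - e k) + (e k - e i) by rewrite addrA subrK.
rewrite (le_trans (tnormD _ _ _))//.
have -> : K / (1 - q) * (q ^+ i - q ^+ k.+1) =
    K * q ^+ k + K / (1 - q) * (q ^+ i - q ^+ k).
  by rewrite exprS; field; rewrite gt_eqF.
apply: lerD; first by apply: step; rewrite leqnn andbT.
apply: IH => // j /andP[ij jk].
by apply: step; rewrite ij ltnW.
Qed.

(** * Choice of the constants and summation in the three settings *)

Theorem theorem2p4 (R : realType) (Gam Gamt lam b c ct B Bt C D : R)
    (hGam : 0 < Gam) (hGamt : 0 < Gamt) (hlam : 0 < lam)
    (hb : 0 < b) (hc : 0 < c) (hct : 0 < ct)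
    (hB : 1 <= B) (hD : 1 <= D) (hBt : 0 < Bt <= 1) (hC : 0 < C <= 1) :
  exists Q1 Qt1 : R,
  forall (M : riemannian_surface R) (Phi : M -> M) (xi0 : M) (k i : nat)
    (e : nat -> 'rV[R]_2),
  (1 <= i <= k)%N ->
  (forall j, (1 <= j <= k)%N -> tderiv (iter j Phi) xi0 \in unitmx) ->
  contracted_dirs Phi xi0 k e ->
  [/\ quasi_hyperbolic_I Gam Gamt lam b c B C D Phi xi0 k ->
        tnorm xi0 (e k - e i) <= Q1 * (Gam * Gamt * c / lam) ^+ i,
      quasi_hyperbolic_II Gam Gamt lam b c ct B Bt C D Phi xi0 k ->
        tnorm xi0 (e k - e i) <= Qt1 * (c / ct) ^+ i &
      Gamt = 1 -> ct = 1 ->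
      non_singular Gam lam b c B Bt C D Phi xi0 k ->
        tnorm xi0 (e k - e i) <= Qt1 * c ^+ i].
Proof.
have [Bt0 _] := andP hBt; have [C0 _] := andP hC.
have B0 : 0 < B by rewrite (lt_le_trans ltr01).
have D0 : 0 < D by rewrite (lt_le_trans ltr01).
(* One step is at most K1 q1^j in type (I), on dividing 2 (D Gam Gamt^j) (B c^j) (D Gam^j) by C
   lam^(j+1), and at most K2 q2^j in type (II), on dividing 2 B c^j by Bt ct^j. *)
pose q1 := Gam * Gamt * c / lam; pose K1 := 2 * D ^+ 2 * Gam * B / (C * lam).
pose q2 := c / ct; pose K2 := 2 * B / Bt.
have q10 : 0 <= q1 by rewrite divr_ge0 ?mulr_ge0 ?ltW.
have q20 : 0 <= q2 by rewrite divr_ge0 ?ltW.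
have K10 : 0 <= K1 by rewrite divr_ge0 ?mulr_ge0 ?exprn_ge0 ?ltW.
have K20 : 0 <= K2 by rewrite divr_ge0 ?mulr_ge0 ?ltW.
exists (K1 / (1 - q1)), (K2 / (1 - q2)) => M Phi xi0 k i e /andP[i1 ik] unit dirs.
have lt_k j : (i <= j < k)%N -> (1 <= j < k)%N.
  by move=> /andP[ij ->]; rewrite andbT (leq_trans i1).
have step j (ijk : (i <= j < k)%N) C2 :=
  contracted_dirs_step (lt_k j ijk) C2 unit dirs.
(* Type (II) and the non-singular setting share this argument, so only their common ingredients are
   assumed. *)
have step2 : q2 < 1 ->
    (forall j, (1 <= j <= k)%N -> C2_at (iter j Phi) xi0) ->
    (forall j, (1 <= j <= k)%N -> coecc (iter j Phi) xi0 <= B * c ^+ j) ->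
    (forall j, (1 <= j <= k)%N ->
      Bt * ct ^+ j.-1 <= coecc Phi (iter j.-1 Phi xi0)) ->
    tnorm xi0 (e k - e i) <= K2 / (1 - q2) * q2 ^+ i.
  move=> q21 C2 coF coPhi; apply: telescope_geometric => //.
    by rewrite q20.
  move=> j ijk; have [_ st] := step j ijk C2.
  have /andP[j1 jk] := lt_k j ijk.
  have coF_j : coecc (iter j Phi) xi0 <= B * c ^+ j by apply: coF; rewrite j1 ltnW.
  (* The point reached after [j] iterates is governed by the hypothesis at time [j.+1], which is
     available since j < k. *)
  have coPhi_j : Bt * ct ^+ j <= coecc Phi (iter j Phi xi0) by exact: (coPhi j.+1).
  have bt0 : 0 < Bt * ct ^+ j by rewrite mulr_gt0 ?exprn_gt0.
  have {}st := st (lt_le_trans bt0 coPhi_j).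
  rewrite /K2 /q2 expr_div_n mulrACA -invfM ler_pdivlMr//.
  rewrite (le_trans (ler_wpM2l (tnorm_ge0 _ _) coPhi_j))// (le_trans st)//.
  by rewrite -mulrA ler_wpM2l.
split.
- move=> [[Gamt1 Gam1 _ H] _ c1 c2].
  have Gaml : lam < Gam by move: Gam1; rewrite gt_max => /andP[].
  have q11 : q1 < 1.
    rewrite ltr_pdivrMr// mul1r.
    have G0 : 0 < Gam * Gamt by rewrite mulr_gt0.
    have lG : lam <= Gam * Gamt by rewrite (le_trans (ltW Gaml))// ler_peMr// ltW.
    (* The bound on [c] makes Gam Gamt c smaller than this quantity, which is at most [lam] because
       lam <= Gam Gamt. *)
    have E : Gam * Gamt * (lam ^+ 3 / (Gam ^+ 3 * Gamt ^+ 3)) =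
        lam * (lam / (Gam * Gamt)) ^+ 2.
      by field; rewrite !gt_eqF.
    apply: (@lt_le_trans _ _ (Gam * Gamt * (lam ^+ 3 / (Gam ^+ 3 * Gamt ^+ 3)))).
      by rewrite ltr_pM2l.
    rewrite E ler_piMr ?(ltW hlam)// exprn_ile1 ?divr_ge0 ?(ltW hlam) ?(ltW G0)//.
    by rewrite ler_pdivrMr// mul1r.
  apply: telescope_geometric => // [|j ijk]; first by rewrite q10.
  have C2 n : (1 <= n <= k)%N -> C2_at (iter n Phi) xi0 by move=> /H[].
  have [st _] := step j ijk C2.
  have /andP[j1 jk] := lt_k j ijk.
  have jk' : (1 <= j <= k)%N by rewrite j1 ltnW.
  have [_ [_ Fj] [co _] _ _] := H j jk'.
  have [_ [FSj _] _ [Pj _] _] := H j.+1 jk.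
  have l0 : 0 < C * lam ^+ j.+1 by rewrite mulr_gt0 ?exprn_gt0.
  have F0 : 0 <= dnorm (iter j Phi) xi0 by exact: opnorm_ge0.
  have P0 : 0 <= dnorm Phi (iter j Phi xi0) by exact: opnorm_ge0.
  (* The lower bound on the norm at time [j.+1] serves as denominator; all other factors are
     replaced by their upper bounds. *)
  rewrite -(ler_pM2r l0).
  rewrite (le_trans (ler_wpM2l (tnorm_ge0 _ _) (ltW FSj)))// (le_trans st)//.
  rewrite (@le_trans _ _ (2 * (D * Gam * Gamt ^+ j * (B * c ^+ j * (D * Gam ^+ j)))))//.
    rewrite ler_wpM2l//.
    rewrite (@le_trans _ _ (dnorm Phi (iter j Phi xi0) * (B * c ^+ j * (D * Gam ^+ j))))//.
      rewrite ler_wpM2l// (le_trans (ler_wpM2r F0 co))// ler_wpM2l ?(ltW Fj)//.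
      by rewrite mulr_ge0 ?exprn_ge0 ?ltW.
    by rewrite ler_wpM2r ?(ltW Pj)// !mulr_ge0 ?exprn_ge0 ?ltW.
  rewrite /K1 /q1 expr_div_n !exprMn (exprS lam) le_eqVlt; apply/orP; left; apply/eqP.
  by field; rewrite !gt_eqF ?exprn_gt0.
- move=> [[Gamt1 Gam1 _ H] coPhi _ [c1 c2 _]]; apply: step2 => //.
  + by rewrite ltr_pdivrMr// mul1r (lt_trans c1).
  + by move=> j /H[].
  + by move=> j /H[_ _ []].
move=> Gamt1 ct1 [_ _ [c1 c2] H].
have -> : c = q2 by rewrite /q2 ct1 divr1.
apply: step2 => //.
- by rewrite /q2 ct1 divr1 (lt_trans c1).
- by move=> j /H[[]].
- by move=> j /H[_ _ [/ltW]].
- by move=> j /H[[_ +] _ _ _ _]; rewrite ct1 expr1n mulr1.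
Qed.
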